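(* Let $\mathtt{I}$ be an instance of SPA-P and let $\mathtt{J}$ be the integer program associated with $\mathtt{I}$ (defined in the context). A feasible solution $S$ to $\mathtt{J}$ is optimal if and only if the corresponding stable matching $M=\{(s_i,p_j): x_{i,j}=1 \text{ in } S\}$ in $\mathtt{I}$ has maximum cardinality among all stable matchings in $\mathtt{I}$.
   Context: SPA-P instance: students $\mathcal{S}=\{s_1,\dots,s_{n_1}\}$, projects $\mathcal{P}=\{p_1,\dots,p_{n_2}\}$, lecturers $\mathcal{L}=\{l_1,\dots,l_{n_3}\}$. Each lecturer $l_k$ offers a non-empty set $P_k\subseteq\mathcal{P}$, and $P_1,\dots,P_{n_3}$ partition $\mathcal{P}$. Each student $s_i$ has an acceptable set $A_i\subseteq\mathcal{P}$ ranked in strict order of preference; each lecturer $l_k$ ranks $P_k$ in strict order. Each project $p_j$ has capacity $c_j\ge1$ and each lecturer $l_k$ capacity $d_k\ge1$ (positive integers). $(s_i,p_j)$ is acceptable if $p_j\in A_i$. A matching $M$ is a set of acceptable pairs with each student in at most one pair, $|M(p_j)|\le c_j$ and $|M(l_k)|\le d_k$, where $M(p_j)$ is the set of students assigned to $p_j$ and $M(l_k)$ the set of students assigned to projects in $P_k$; $M(s_i)$ is the project of $s_i$. A project (lecturer) is undersubscribed if it has fewer assigned students than its capacity, full if equal; $p_j$ is non-empty if $|M(p_j)|>0$. An acceptable pair $(s_i,p_j)\notin M$, with $p_j\in P_k$, is a blocking pair if $s_i$ is unassigned or prefers $p_j$ to $M(s_i)$, $p_j$ is undersubscribed, and either (a)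 $s_i\in M(l_k)$ and $l_k$ prefers $p_j$ to $M(s_i)$, or (b) $s_i\notin M(l_k)$ and $l_k$ is undersubscribed, or (c) $s_i\notin M(l_k)$ and $l_k$ prefers $p_j$ to his worst non-empty project. A coalition is a set $\{s_{i_0},\dots,s_{i_{r-1}}\}$, $r\ge2$, of assigned students such that each $s_{i_t}$ prefers $M(s_{i_{t+1}})$ to $M(s_{i_t})$ (indices mod $r$). $M$ is stable if it has no blocking pair and no coalition. The IP $\mathtt{J}$: $rank(s_i,p_j)$ is $1+$ the number of projects $s_i$ prefers to $p_j$; similarly $rank(l_k,p_j)$. Let $S_{i,j}=\{p_{j'}\in A_i: rank(s_i,p_{j'})\le rank(s_i,p_j)\}$, $T_{k,j}=\{p_q\in P_k: rank(l_k,p_j)<rank(l_k,p_q)\}$, $D_{k,j}=\{p_{j'}\in P_k: rank(l_k,p_{j'})\le rank(l_k,p_j)\}$. Variables: binary $x_{i,j}$ for each acceptable pair $(s_i,p_j)$ (sums below range over existing variables only); binary $\alpha_j$ for each project; binary $\delta_k$ for each lecturer; binary $\eta_{j,k}$; binary $e_{i,i'}$ for each ordered pair of distinct students; integer $v_i$ for each student. Abbreviations: $\theta_{i,j}=1-\sum_{p_{j'}\in S_{i,j}}x_{i,j'}$, $\gamma_{i,j,k}=\sum_{p_{j'}\in T_{k,j}}x_{i,j'}$, $\beta_{i,k}=\sum_{p_{j'}\in P_k}x_{i,j'}$. Constraints: (1) $\sum_{p_j\in A_i}x_{i,j}\le1$ for all $i$; (2) $\sum_{i}x_{i,j}\le c_j$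 for all $j$; (3) $\sum_i\sum_{p_j\in P_k}x_{i,j}\le d_k$ for all $k$; (4) $c_j\alpha_j\ge c_j-\sum_{i'}x_{i',j}$ for all $j$; (5) $d_k\delta_k\ge d_k-\sum_{i'}\sum_{p_{j'}\in P_k}x_{i',j'}$ for all $k$; (6) $d_k\eta_{j,k}\ge d_k-\sum_{i'}\sum_{p_{j'}\in D_{k,j}}x_{i',j'}$ for all $k$ and $p_j\in P_k$; and for every acceptable pair $(s_i,p_j)$ with $p_j\in P_k$: (7) $\theta_{i,j}+\alpha_j+\gamma_{i,j,k}\le2$, (8) $\theta_{i,j}+\alpha_j+(1-\beta_{i,k})+\delta_k\le3$, (9) $\theta_{i,j}+\alpha_j+(1-\beta_{i,k})+\eta_{j,k}\le3$; (10) for all distinct $i,i'$ and all $j,j'$ such that $s_i$ prefers $p_{j'}$ to $p_j$: $e_{i,i'}+1\ge x_{i,j}+x_{i',j'}$; (11) for all distinct $i,i'$: $v_i<v_{i'}+n_1(1-e_{i,i'})$. Objective: maximise $\sum_i\sum_{p_j\in A_i}x_{i,j}$. A feasible solution is optimal if it maximises the objective among all feasible solutions. *)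

(* Defs.v *)
From mathcomp Require Import all_boot all_order all_algebra.

Set Implicit Arguments.
Unset Strict Implicit.
Unset Printing Implicit Defensive.

Import Order.TTheory GRing.Theory Num.Theory.

Local Open Scope ring_scope.

(* Students, projects and lecturers are 'I_n1, 'I_n2, 'I_n3.
   Preference relations read [better, worse] and hold only between projects
   ranked by the agent, so each is a strict total order on that agent's set. *)
Record spap (n1 n2 n3 : nat) := SPAP {
  acc : 'I_n1 -> {set 'I_n2};
  offers : 'I_n3 -> {set 'I_n2};
  sprefers : 'I_n1 -> rel 'I_n2;
  lprefers : 'I_n3 -> rel 'I_n2;
  pcap : 'I_n2 -> nat;
  lcap : 'I_n3 -> nat;
  offers_neq0 : forall k, offers k != set0;
  offers_disjoint : forall k k', k != k' -> [disjoint offers k & offers k'];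
  offers_cover : \bigcup_k offers k = [set: 'I_n2];
  sprefers_acc : forall i p q, sprefers i p q -> (p \in acc i) && (q \in acc i);
  sprefers_irr : forall i, irreflexive (sprefers i);
  sprefers_trans : forall i, transitive (sprefers i);
  sprefers_total : forall i, {in acc i &, forall p q,
    p != q -> sprefers i p q || sprefers i q p};
  lprefers_offers : forall k p q,
    lprefers k p q -> (p \in offers k) && (q \in offers k);
  lprefers_irr : forall k, irreflexive (lprefers k);
  lprefers_trans : forall k, transitive (lprefers k);
  lprefers_total : forall k, {in offers k &, forall p q,
    p != q -> lprefers k p q || lprefers k q p};
  pcap_gt0 : forall j, (0 < pcap j)%N;
  lcap_gt0 : forall k, (0 < lcap k)%N
}.

Section Instance.
Variables (n1 n2 n3 : nat) (I : spap n1 n2 n3).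

Implicit Types (i : 'I_n1) (j p q : 'I_n2) (k : 'I_n3).
Implicit Types (M : {set 'I_n1 * 'I_n2}).

Definition studs_of_proj M j : {set 'I_n1} := [set i | (i, j) \in M].

Definition studs_of_lect M k : {set 'I_n1} :=
  [set i | [exists j in offers I k, (i, j) \in M]].

Definition assigned M i : bool := [exists j, (i, j) \in M].

Record matching M : Prop := Matching {
  matching_acc : forall i j, (i, j) \in M -> j \in acc I i;
  matching_stud : forall i j j', (i, j) \in M -> (i, j') \in M -> j = j';
  matching_pcap : forall j, (#|studs_of_proj M j| <= pcap I j)%N;
  matching_lcap : forall k, (#|studs_of_lect M k| <= lcap I k)%N
}.

Definition proj_undersubscribed M j : bool :=
  (#|studs_of_proj M j| < pcap I j)%N.

Definition lect_undersubscribed M k : bool :=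
  (#|studs_of_lect M k| < lcap I k)%N.

Definition proj_nonempty M j : bool := (0 < #|studs_of_proj M j|)%N.

(* In a matching the witness [q] below is the unique project M(s_i); both
   predicates are false when s_i is unassigned. *)
Definition sprefers_assigned M i j : bool :=
  [exists q, ((i, q) \in M) && sprefers I i j q].

Definition lprefers_assigned M k i j : bool :=
  [exists q, ((i, q) \in M) && lprefers I k j q].

Definition worst_nonempty M k q : Prop :=
  [/\ q \in offers I k, proj_nonempty M q &
      forall q', q' \in offers I k -> proj_nonempty M q' -> q' != q ->
        lprefers I k q' q].

Definition blocking_pair M i j : Prop :=
  exists2 k, j \in offers I k &
  [/\ j \in acc I i, (i, j) \notin M,
      ~~ assigned M i \/ sprefers_assigned M i j,
      proj_undersubscribed M j &
      [\/ i \in studs_of_lect M k /\ lprefers_assigned M k i j,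
          i \notin studs_of_lect M k /\ lect_undersubscribed M k |
          i \notin studs_of_lect M k /\
            exists2 q, worst_nonempty M k q & lprefers I k j q]].

Definition envies M : rel 'I_n1 := fun i i' =>
  [exists q, ((i', q) \in M) && sprefers_assigned M i q].

(* The sequence lists s_{i_0}, ..., s_{i_{r-1}} in cyclic order. *)
Definition coalition M (c : seq 'I_n1) : Prop :=
  [/\ (2 <= size c)%N, uniq c & cycle (envies M) c].

Definition stable_matching M : Prop :=
  [/\ matching M, forall i j, ~ blocking_pair M i j &
      forall c, ~ coalition M c].

Definition max_stable_matching M : Prop :=
  stable_matching M /\
  forall M', stable_matching M' -> (#|M'| <= #|M|)%N.

Definition srank i p : nat := #|[set q | sprefers I i q p]|.+1.

Definition lrank k p : nat := #|[set q | lprefers I k q p]|.+1.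

Definition Sset i j : {set 'I_n2} :=
  [set p in acc I i | (srank i p <= srank i j)%N].

Definition Tset k j : {set 'I_n2} :=
  [set p in offers I k | (lrank k j < lrank k p)%N].

Definition Dset k j : {set 'I_n2} :=
  [set p in offers I k | (lrank k p <= lrank k j)%N].

(* Indexing the x variables by this type makes every sum range over existing
   variables only. *)
Definition apair := {a : 'I_n1 * 'I_n2 | a.2 \in acc I a.1}.

Definition stud (a : apair) : 'I_n1 := (val a).1.

Definition proj (a : apair) : 'I_n2 := (val a).2.

(* The diagonal values of [ve] and the values [veta j k] with p_j not offered
   by l_k occur in no constraint. *)
Record assignment := Assignment {
  vx : apair -> int;
  valpha : 'I_n2 -> int;
  vdelta : 'I_n3 -> int;
  veta : 'I_n2 -> 'I_n3 -> int;
  ve : 'I_n1 -> 'I_n1 -> int;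
  vv : 'I_n1 -> int
}.

Implicit Types (S : assignment) (a b : apair).

Definition binary (z : int) : bool := (z == 0) || (z == 1).

Definition theta S i j : int :=
  1 - \sum_(b : apair | (stud b == i) && (proj b \in Sset i j)) vx S b.

Definition gamma S i j k : int :=
  \sum_(b : apair | (stud b == i) && (proj b \in Tset k j)) vx S b.

Definition beta S i k : int :=
  \sum_(b : apair | (stud b == i) && (proj b \in offers I k)) vx S b.

Record feasible S : Prop := Feasible {
  bin_x : forall a, binary (vx S a);
  bin_alpha : forall j, binary (valpha S j);
  bin_delta : forall k, binary (vdelta S k);
  bin_eta : forall k j, j \in offers I k -> binary (veta S j k);
  bin_e : forall i i', i != i' -> binary (ve S i i');
  cstr1 : forall i, \sum_(b : apair | stud b == i) vx S b <= 1;
  cstr2 : forall j, \sum_(b : apair | proj b == j) vx S b <= (pcap I j)%:Z;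
  cstr3 : forall k,
    \sum_(b : apair | proj b \in offers I k) vx S b <= (lcap I k)%:Z;
  cstr4 : forall j,
    (pcap I j)%:Z * valpha S j >=
    (pcap I j)%:Z - \sum_(b : apair | proj b == j) vx S b;
  cstr5 : forall k,
    (lcap I k)%:Z * vdelta S k >=
    (lcap I k)%:Z - \sum_(b : apair | proj b \in offers I k) vx S b;
  cstr6 : forall k j, j \in offers I k ->
    (lcap I k)%:Z * veta S j k >=
    (lcap I k)%:Z - \sum_(b : apair | proj b \in Dset k j) vx S b;
  cstr7 : forall a k, proj a \in offers I k ->
    theta S (stud a) (proj a) + valpha S (proj a)
    + gamma S (stud a) (proj a) k <= 2;
  cstr8 : forall a k, proj a \in offers I k ->
    theta S (stud a) (proj a) + valpha S (proj a)
    + (1 - beta S (stud a) k) + vdelta S k <= 3;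
  cstr9 : forall a k, proj a \in offers I k ->
    theta S (stud a) (proj a) + valpha S (proj a)
    + (1 - beta S (stud a) k) + veta S (proj a) k <= 3;
  cstr10 : forall a b, stud a != stud b ->
    sprefers I (stud a) (proj b) (proj a) ->
    ve S (stud a) (stud b) + 1 >= vx S a + vx S b;
  cstr11 : forall i i', i != i' ->
    vv S i < vv S i' + n1%:Z * (1 - ve S i i')
}.

Definition objective S : int := \sum_(a : apair) vx S a.

Definition optimal S : Prop :=
  feasible S /\ forall S', feasible S' -> objective S' <= objective S.

Definition matching_of S : {set 'I_n1 * 'I_n2} :=
  [set val a | a : apair & vx S a == 1].

End Instance.

(* Main.v *)
(* For a feasible solution, [theta], [gamma] and [beta] are 0/1 indicators, so
   constraints (4)-(9) say exactly that the matching has no blocking pair, and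
   the potentials [vv] increase along envy, which excludes coalitions.
   Conversely, for a stable matching set each of the other binary variables to
   the truth value of the condition it stands for; the envy graph is acyclic, so
   the number of its vertices that reach s_i serves as v_i, and as it lies
   between 1 and n1, constraint (11) is vacuous when e_{i,i'} = 0. Stable
   matchings and feasible solutions thus correspond, and the objective is the
   size of the matching. *)
Require Import Defs.
From mathcomp Require Import all_boot all_order all_algebra.
From mathcomp Require Import zify.

Set Implicit Arguments.
Unset Strict Implicit.
Unset Printing Implicit Defensive.

Import Order.TTheory GRing.Theory Num.Theory.

Local Open Scope ring_scope.

(** * Ranks and heights in finite relations *)

(** If [r x y], transitivity nests the sets above [x] and [y], and [x] itself makes the inclusion
    strict; totality on [A] yields the converse. Through this, comparing ranks amounts to comparing
    preferences. *)
Lemma card_above_ltn (T : finType) (r : rel T) (A : {set T}) :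
  irreflexive r -> transitive r ->
  {in A &, forall x y, x != y -> r x y || r y x} ->
  {in A &, forall x y,
    (#|[set z | r z x]| < #|[set z | r z y]|)%N = r x y}.
Proof.
move=> irr tr tot x y xA yA.
have mono u w : r u w -> (#|[set z | r z u]| < #|[set z | r z w]|)%N.
  move=> ruw; apply/proper_card/properP; split.
    by apply/subsetP=> z; rewrite !inE => /tr; apply.
  by exists u; rewrite !inE ?irr.
apply/idP/idP=> [lt_xy|]; last exact: mono.
have [exy|nexy] := eqVneq x y; first by rewrite exy ltnn in lt_xy.
case/orP: (tot _ _ xA yA nexy) => // /mono lt_yx.
by have := ltn_trans lt_xy lt_yx; rewrite ltnn.
Qed.

Lemma connect_cycle (T : finType) (e : rel T) x y :
  x != y -> e x y -> connect e y x ->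
  exists c, [/\ (2 <= size c)%N, uniq c & cycle e c].
Proof.
move=> nexy exy /connectP[p ep xl]; case/shortenP: ep xl => p' ep' up' _ xl.
exists (y :: p'); split=> //.
  by case: p' xl {ep' up'} => //= xy; rewrite xy eqxx in nexy.
by rewrite /cycle rcons_path ep' -xl.
Qed.

(** Along an edge from [x] to [y], whatever reaches [x] reaches [y], and [y] itself is new, as
    otherwise a cycle closes. Loops are excluded separately since the forbidden cycles have length
    at least two. *)
Lemma acyclic_height (T : finType) (e : rel T) :
  irreflexive e ->
  (forall c, ~ [/\ (2 <= size c)%N, uniq c & cycle e c]) ->
  exists2 h : T -> nat, forall x, (0 < h x <= #|T|)%N
                      & forall x y, e x y -> (h x < h y)%N.
Proof.
move=> irr acyc; exists (fun x => #|[set z | connect e z x]|) => [x|x y exy].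
  by rewrite max_card andbT card_gt0; apply/set0Pn; exists x; rewrite inE.
apply/proper_card/properP; split.
  apply/subsetP=> z; rewrite !inE => /connect_trans; apply; exact: connect1.
exists y; rewrite !inE ?connect0 //; apply/negP=> cyx.
have nexy : x != y by apply: contraTneq exy => ->; rewrite irr.
by have [c /acyc] := connect_cycle nexy exy cyx.
Qed.

Section Instance.
Variables (n1 n2 n3 : nat) (I : spap n1 n2 n3).

Implicit Types (i : 'I_n1) (j p q : 'I_n2) (k : 'I_n3).
Implicit Types (M : {set 'I_n1 * 'I_n2}) (S : assignment I).

(** * Preference sets and worst non-empty projects *)

Lemma offers_inj j k k' : j \in offers I k -> j \in offers I k' -> k = k'.
Proof.
move=> jk jk'; apply/eqP/negPn/negP=> /(offers_disjoint I).
by move/disjoint_setI0/setP/(_ j); rewrite !inE jk jk'.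
Qed.

Lemma mem_Sset i j q : j \in acc I i ->
  (q \in Sset I i j) = (q \in acc I i) && ~~ sprefers I i j q.
Proof.
move=> ja; rewrite inE; case qa: (q \in acc I i) => //=.
rewrite -(card_above_ltn (@sprefers_irr _ _ _ I i) (@sprefers_trans _ _ _ I i)
            (@sprefers_total _ _ _ I i)) //.
by rewrite -leqNgt.
Qed.

Lemma lrank_ltn k : {in offers I k &, forall p q,
  (lrank I k p < lrank I k q)%N = lprefers I k p q}.
Proof.
exact: (card_above_ltn (@lprefers_irr _ _ _ I k) (@lprefers_trans _ _ _ I k)
          (@lprefers_total _ _ _ I k)).
Qed.

Lemma mem_Tset k j q : j \in offers I k ->
  (q \in Tset I k j) = lprefers I k j q.
Proof.
move=> jk; rewrite inE; case qk: (q \in offers I k) => /=.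
  by rewrite lrank_ltn.
by apply/esym/negP=> /lprefers_offers; rewrite qk andbF.
Qed.

Lemma mem_Dset k j q : j \in offers I k ->
  (q \in Dset I k j) = (q \in offers I k) && ~~ lprefers I k j q.
Proof.
move=> jk; rewrite inE; case qk: (q \in offers I k) => //=.
by rewrite -lrank_ltn // -leqNgt.
Qed.

Lemma worst_nonempty_exists M k q : q \in offers I k -> proj_nonempty M q ->
  exists2 w, worst_nonempty I M k w & (lrank I k q <= lrank I k w)%N.
Proof.
move=> qk nq.
pose P q' := (q' \in offers I k) && proj_nonempty M q'.
have Pq : P q by rewrite /P qk.
case: (arg_maxnP (lrank I k) Pq) => w /andP[wk nw] wmax.
exists w; last exact: wmax.
split=> // q' q'k nq' /(lprefers_total q'k wk)/orP[] //.
by rewrite -[lprefers I k w q']lrank_ltn // ltnNge [(_ <= _)%N]wmax // /P q'k.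
Qed.

(** * Counting pairs of a matching *)

(** This and [functional] isolate two clauses of [matching], so that the counting lemmas apply to
    [matching_of S] before it is known to be a matching. *)
Definition acceptable M := forall i j, (i, j) \in M -> j \in acc I i.

Definition functional M :=
  forall i j j', (i, j) \in M -> (i, j') \in M -> j = j'.

Lemma card_studs_of_proj M j :
  #|studs_of_proj M j| = #|[set m in M | m.2 == j]|.
Proof.
rewrite -(card_imset (mem (studs_of_proj M j)) (f := fun i => (i, j)));
    last by move=> i i' [].
apply: eq_card => -[i j']; rewrite !inE /=.
apply/imsetP/andP=> [[i']|[mM /eqP ej]].
  by rewrite inE => iM [-> ->].
by exists i; rewrite ?inE -?ej.
Qed.

Lemma card_studs_of_lect M k : functional M ->
  #|studs_of_lect I M k| = #|[set m in M | m.2 \in offers I k]|.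
Proof.
move=> fM; rewrite -[RHS](card_in_imset (f := fst)); last first.
  case=> [i j] [i' j']; rewrite !inE /= => /andP[jM _] /andP[jM' _] ei.
  by rewrite -ei in jM' *; rewrite (fM _ _ _ jM jM').
apply: eq_card => i; rewrite inE; apply/existsP/imsetP=> [[j /andP[jk jM]]|].
  by exists (i, j); rewrite ?inE ?jM.
by case=> -[i' j]; rewrite inE /= => /andP[jM jk] ->; exists j; rewrite jk.
Qed.

Lemma card_Dset_leq M k j : functional M ->
  (#|[set m in M | m.2 \in Dset I k j]| <= #|studs_of_lect I M k|)%N.
Proof.
move=> fM; rewrite card_studs_of_lect //; apply/subset_leq_card/subsetP=> m.
by rewrite !inE => /and3P[-> ->].
Qed.

Lemma card_stud_row M i (Q : {set 'I_n2}) : functional M ->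
  #|[set m in M | (m.1 == i) && (m.2 \in Q)]| = [exists q in Q, (i, q) \in M].
Proof.
move=> fM; case: existsP => [[q /andP[qQ qM]]|nex].
  rewrite -[RHS]/1%N -(cards1 (i, q)); apply: eq_card => -[i' q'].
  rewrite !inE /= xpair_eqE.
  apply/and3P/andP=> [[qM' /eqP ei _]|[/eqP-> /eqP->]]; last by [].
  by rewrite ei in qM' *; rewrite (fM _ _ _ qM qM').
apply: eq_card0 => -[i' q]; rewrite !inE /=; apply/and3P=> -[qM /eqP ei qQ].
by apply: nex; exists q; rewrite qQ -ei.
Qed.

(** Restates blocking through the quantities that the constraints measure. Cases (b) and (c) merge
    into one strict bound: fewer than [lcap I k] students sit on projects that [l_k] ranks no worse
    than [j]. *)
Lemma blocking_pairP M i j k : matching I M -> j \in offers I k ->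
  blocking_pair I M i j <->
  [/\ j \in acc I i, ~~ [exists q in Sset I i j, (i, q) \in M],
      proj_undersubscribed I M j &
      [exists q in Tset I k j, (i, q) \in M] ||
      (i \notin studs_of_lect I M k) &&
      (#|[set m in M | m.2 \in Dset I k j]| < lcap I k)%N].
Proof.
case=> aM fM _ lM jk; split.
  case=> k' jk' [ja jM pref uj blk].
  rewrite -{k' jk'}(offers_inj jk jk') in blk; split=> //.
    apply/existsP=> -[q]; rewrite mem_Sset // => /andP[/andP[_ nj] qM].
    case: pref => [/negP|/existsP[q' /andP[q'M]]].
      by apply; apply/existsP; exists q.
    by rewrite (fM _ _ _ q'M qM) (negPf nj).
  apply/orP; case: blk => [[_ /existsP[q /andP[qM jq]]]|[ni ul]|[ni [q [qk nq _] jq]]].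
  - by left; apply/existsP; exists q; rewrite mem_Tset // jq.
  - by right; rewrite ni; apply: leq_ltn_trans (card_Dset_leq _ _ fM) ul.
  (* A student on the worst project [q] counts for [l_k] but lies outside [Dset I k j], which makes
     the bound strict. *)
  - right; rewrite ni; apply: leq_trans (lM k).
    rewrite (card_studs_of_lect _ fM); apply/proper_card/properP; split.
      by apply/subsetP=> m; rewrite !inE => /and3P[-> ->].
    case/card_gt0P: nq => s; rewrite inE => sM; exists (s, q).
      by rewrite inE sM.
    by rewrite in_set mem_Dset //= jq !andbF.
case=> ja /existsP nS uj blk; exists k => //.
(* [j] belongs to its own [Sset I i j]. *)
have jM : (i, j) \notin M.
  apply/negP=> jM; apply: nS; exists j.
  by rewrite mem_Sset // ja jM sprefers_irr.
have pref q : (i, q) \in M -> sprefers I i j q.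
  move=> qM; apply: contra_notT nS => nj; exists q.
  by rewrite mem_Sset // (aM _ _ qM) nj.
split=> //.
  rewrite /assigned; case: existsP => [[q qM]|_]; last by left.
  by right; apply/existsP; exists q; rewrite qM pref.
case/orP: blk => [/existsP[q]|/andP[ni ltD]].
  rewrite mem_Tset // => /andP[jq qM]; apply: Or31; split.
    rewrite inE; apply/existsP; exists q; rewrite qM andbT.
    by case/andP: (lprefers_offers jq).
  by apply/existsP; exists q; rewrite qM.
have [ul|full] := boolP (lect_undersubscribed I M k); first exact: Or32.
apply: Or33; split=> //.
(* A full lecturer must have someone on a project outside [Dset I k j]. *)
have /subsetPn[[s q]] :
    ~~ ([set m in M | m.2 \in offers I k]
       \subset [set m in M | m.2 \in Dset I k j]).
  apply: contra full => /subset_leq_card le_kD.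
  by rewrite /lect_undersubscribed card_studs_of_lect // (leq_ltn_trans le_kD).
rewrite inE => /andP[sM qk]; rewrite in_set sM mem_Dset //= in qk *.
rewrite qk negbK /= => jq.
have [|w wP le_qw] := worst_nonempty_exists qk (M := M).
  by apply/card_gt0P; exists s; rewrite inE.
exists w => //; case: wP => wk _ _.
by rewrite -lrank_ltn //; apply: leq_trans le_qw; rewrite lrank_ltn.
Qed.

(** * Sums of variables as cardinalities *)

Definition encodes S M := forall b, vx S b = ((val b \in M) : nat)%:Z.

(** Acceptability gives every pair of [M] a variable, so no pair is lost when the sum ranges over
    [apair I]. *)
Lemma encodes_sum S M (P : pred ('I_n1 * 'I_n2)) : encodes S M -> acceptable M ->
  \sum_(b : apair I | P (val b)) vx S b = #|[set m in M | P m]|%:Z.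
Proof.
move=> xM aM.
transitivity ((\sum_(b : apair I | P (val b)) (val b \in M))%N%:Z).
  by rewrite (big_morph Posz PoszD (erefl 0%:Z)); apply: eq_bigr.
congr Posz; rewrite -big_mkcondr /= sum1_card -(card_imset _ val_inj).
apply: eq_card => m; rewrite [in RHS]inE; apply/imsetP/andP.
  by case=> b /andP[Pb bM] ->.
case=> mM Pm; have ma : m.2 \in acc I m.1
  by apply: aM; rewrite -surjective_pairing.
by exists (exist _ m ma) => //; apply/andP.
Qed.

Section Encoding.
Variables (S : assignment I) (M : {set 'I_n1 * 'I_n2}).
Hypotheses (xM : encodes S M) (aM : acceptable M).

Lemma objective_card : objective S = #|M|%:Z.
Proof.
rewrite /objective (encodes_sum predT xM aM); congr Posz.
by apply: eq_card => m; rewrite !inE andbT.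
Qed.

Lemma proj_sumE j :
  \sum_(b : apair I | proj b == j) vx S b = #|studs_of_proj M j|%:Z.
Proof.
by rewrite (encodes_sum (fun m => m.2 == j) xM aM) card_studs_of_proj.
Qed.

Lemma Dset_sumE k j :
  \sum_(b : apair I | proj b \in Dset I k j) vx S b
  = #|[set m in M | m.2 \in Dset I k j]|%:Z.
Proof. exact: (encodes_sum (fun m => m.2 \in Dset I k j) xM aM). Qed.

Hypothesis fM : functional M.

Lemma lect_sumE k :
  \sum_(b : apair I | proj b \in offers I k) vx S b = #|studs_of_lect I M k|%:Z.
Proof.
by rewrite (encodes_sum (fun m => m.2 \in offers I k) xM aM) card_studs_of_lect.
Qed.

Lemma stud_sumE i (Q : {set 'I_n2}) :
  \sum_(b : apair I | (stud b == i) && (proj b \in Q)) vx S b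
  = ([exists q in Q, (i, q) \in M] : nat)%:Z.
Proof.
rewrite (encodes_sum (fun m => (m.1 == i) && (m.2 \in Q)) xM aM).
by rewrite card_stud_row.
Qed.

Lemma betaE i k : beta S i k = ((i \in studs_of_lect I M k) : nat)%:Z.
Proof. by rewrite /beta stud_sumE inE. Qed.

End Encoding.

(** * From feasible solutions to stable matchings *)

Lemma matching_of_acceptable S : acceptable (matching_of S).
Proof. by move=> i j /imsetP[[m ma] _ /= e]; rewrite -e in ma. Qed.

Lemma encodes_matching_of S :
  (forall a, binary (vx S a)) -> encodes S (matching_of S).
Proof.
move=> binx b; rewrite mem_imset; last exact: val_inj.
by rewrite inE; case/orP: (binx b) => /eqP->.
Qed.

Lemma feasible_functional S : feasible S -> functional (matching_of S).
Proof.
move=> fS i j j' jM j'M; apply/eqP/negPn/negP=> nej.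
have := cstr1 fS i.
rewrite (encodes_sum (fun m => m.1 == i) (encodes_matching_of (bin_x fS))
          (@matching_of_acceptable S)).
apply/negP; rewrite -ltNge ltz_nat.
have <- : #|[set (i, j); (i, j')]| = 2%N by rewrite cards2 xpair_eqE eqxx /= nej.
apply/subset_leq_card/subsetP=> m; rewrite !inE.
by case/orP=> /eqP->; rewrite ?jM ?j'M eqxx.
Qed.

Lemma feasible_matching S : feasible S -> matching I (matching_of S).
Proof.
move=> fS; have xM := encodes_matching_of (bin_x fS).
have aM := @matching_of_acceptable S; have fM := feasible_functional fS.
split=> // [j|k].
  by have := cstr2 fS j; rewrite (proj_sumE xM aM) lez_nat.
by have := cstr3 fS k; rewrite (lect_sumE xM aM fM) lez_nat.
Qed.

Lemma capacity_indicator (c n : nat) (z : int) :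
  binary z -> (n < c)%N -> c%:Z - n%:Z <= c%:Z * z -> z = 1.
Proof. by case/orP=> /eqP-> //; lia. Qed.

(** A blocking pair would make every term on the left of (7), or of (9), equal to 1, one more in
    total than the bound allows. *)
Lemma feasible_no_blocking S i j :
  feasible S -> ~ blocking_pair I (matching_of S) i j.
Proof.
move=> fS bp; have xM := encodes_matching_of (bin_x fS).
have aM := @matching_of_acceptable S; have mM := feasible_matching fS.
have fM := matching_stud mM; have [k jk _] := bp.
have [ja nS uj blk] := (blocking_pairP i mM jk).1 bp.
pose a : apair I := exist _ (i, j) ja.
have al1 : valpha S j = 1.
  apply: capacity_indicator (bin_alpha fS j) uj _.
  by have := cstr4 fS j; rewrite (proj_sumE xM aM).
have th1 : theta S i j = 1.
  by rewrite /theta (stud_sumE xM aM fM) (negPf nS).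
have := @cstr7 _ _ _ _ _ fS a k jk; have := @cstr9 _ _ _ _ _ fS a k jk.
rewrite /stud /proj /= th1 al1 (betaE xM aM fM) /gamma (stud_sumE xM aM fM).
case/orP: blk => [->|/andP[/negPf-> ltD]] //.
rewrite (capacity_indicator (bin_eta fS jk) ltD) //.
by have := cstr6 fS jk; rewrite (Dset_sumE xM aM).
Qed.

Lemma feasible_no_coalition S c : feasible S -> ~ coalition I (matching_of S) c.
Proof.
move=> fS; have xM := encodes_matching_of (bin_x fS).
have fM := feasible_functional fS.
have lt_v x y : envies I (matching_of S) x y -> vv S x < vv S y.
  case/existsP=> q /andP[qM /existsP[p /andP[pM qp]]].
  (* Constraints (10) and (11) cover distinct students only; self-envy would need a project
     preferred to itself. *)
  have nexy : x != y.
    by apply: contraTneq qp => exy; rewrite -exy in qM;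
      rewrite (fM _ _ _ qM pM) sprefers_irr.
  have pa := matching_of_acceptable pM; have qa := matching_of_acceptable qM.
  pose a : apair I := exist _ (x, p) pa; pose b : apair I := exist _ (y, q) qa.
  have := @cstr10 _ _ _ _ _ fS a b nexy qp; rewrite !xM /= pM qM /stud /=.
  have := cstr11 fS nexy; case/orP: (bin_e fS nexy) => /eqP-> //.
  by rewrite subrr mulr0 addr0.
case=> size_c _; case: c size_c => // x c _ cyc.
(* The cycle is a path from [x] back to [x]; by transitivity its last vertex would have a potential
   above that of [x]. *)
have: path (relpre (vv S) <%R) x (rcons c x)
  by apply: sub_path cyc => ? ?; apply: lt_v.
rewrite -path_map.
move/(order_path_min lt_trans)/allP/(_ (vv S x)).
by rewrite map_f ?mem_rcons ?mem_head // ltxx => /(_ isT).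
Qed.

Lemma feasible_stable S : feasible S -> stable_matching I (matching_of S).
Proof.
move=> fS; split; first exact: feasible_matching.
  by move=> i j; apply: feasible_no_blocking.
by move=> c; apply: feasible_no_coalition.
Qed.

(** * From stable matchings to feasible solutions *)

(** For a matching, [valpha], [vdelta] and [veta] get the least values that (4)-(6) allow, which
    favours (7)-(9). *)
Definition assignment_of M (h : 'I_n1 -> nat) : assignment I := {|
  vx := fun b => ((val b \in M) : nat)%:Z;
  valpha := fun j => (proj_undersubscribed I M j : nat)%:Z;
  vdelta := fun k => (lect_undersubscribed I M k : nat)%:Z;
  veta := fun j k =>
    ((#|[set m in M | m.2 \in Dset I k j]| < lcap I k)%N : nat)%:Z;
  ve := fun i i' => (envies I M i i' : nat)%:Z;
  vv := fun i => (h i)%:Z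
|}.

Lemma matching_of_assignment_of M h : acceptable M ->
  matching_of (assignment_of M h) = M.
Proof.
move=> aM; apply/setP=> -[i j]; apply/imsetP/idP=> [[b]|jM].
  by rewrite inE /=; case: (boolP (val b \in M)) => // bM _ ->.
by exists (exist _ (i, j) (aM _ _ jM)); rewrite // inE /= jM.
Qed.

Lemma binary_nat_of_bool (b : bool) : binary (b : nat)%:Z.
Proof. by case: b. Qed.

Lemma stable_assignment_feasible M (h : 'I_n1 -> nat) : stable_matching I M ->
  (forall i, 0 < h i <= n1)%N ->
  (forall i i', envies I M i i' -> (h i < h i')%N) ->
  feasible (assignment_of M h).
Proof.
case=> mM noblk _ hb hmono; set S := assignment_of M h.
have xM : encodes S M by [].
have [aM fM pM lM] := mM.
have capb (c n : nat) : c%:Z - n%:Z <= c%:Z * ((n < c)%N : nat)%:Z.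
  by case: ltnP; lia.
(* The absence of blocking pairs, in the form in which (7)-(9) are checked by cases on the
   indicators. *)
have ncond (a : apair I) k : proj a \in offers I k ->
    ~ [/\ ~~ [exists q in Sset I (stud a) (proj a), (stud a, q) \in M],
      proj_undersubscribed I M (proj a) &
      [exists q in Tset I k (proj a), (stud a, q) \in M] ||
      (stud a \notin studs_of_lect I M k) &&
      (#|[set m in M | m.2 \in Dset I k (proj a)]| < lcap I k)%N].
  move=> ak [nS ua blk]; apply: (noblk (stud a) (proj a)).
  by apply/(blocking_pairP _ mM ak); split=> //; apply: (valP a).
split=> [a|j|k|k j _|i i' _|i|j|k|j|k|k j _|a k ak|a k ak|a k ak|a b neab pab|i i' ne];
  try exact: binary_nat_of_bool.
- rewrite (encodes_sum (fun m => m.1 == i) xM aM).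
  (* Constraint (1) is the row count over the full set of projects. *)
  have -> : [set m in M | m.1 == i]
          = [set m in M | (m.1 == i) && (m.2 \in [set: 'I_n2])].
    by apply/setP=> m; rewrite !inE andbT.
  by rewrite card_stud_row // lez_nat leq_b1.
- by rewrite (proj_sumE xM aM) lez_nat.
- by rewrite (lect_sumE xM aM fM) lez_nat.
- by rewrite (proj_sumE xM aM); apply: capb.
- by rewrite (lect_sumE xM aM fM); apply: capb.
- by rewrite (Dset_sumE xM aM); apply: capb.
- rewrite /theta /gamma !(stud_sumE xM aM fM) /=.
  have := ncond a k ak.
  case: [exists q in Sset _ _ _, _]; case: (proj_undersubscribed _ _ _) => //;
    case: [exists q in Tset _ _ _, _] => //.
  by move=> nc; case: nc.
- rewrite /theta (betaE xM aM fM) !(stud_sumE xM aM fM) /=.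
  have := ncond a k ak.
  case: [exists q in Sset _ _ _, _]; case: (proj_undersubscribed _ _ _) => //;
    case: (_ \in studs_of_lect _ _ _) => //;
    case ul: (lect_undersubscribed _ _ _) => // nc; case: nc; split=> //.
  (* An undersubscribed lecturer also satisfies the strict bound on [Dset], so (8) follows from
     [ncond] too. *)
  by apply/orP; right; apply: leq_ltn_trans (card_Dset_leq _ _ fM) ul.
- rewrite /theta (betaE xM aM fM) !(stud_sumE xM aM fM) /=.
  have := ncond a k ak.
  case: [exists q in Sset _ _ _, _]; case: (proj_undersubscribed _ _ _) => //;
    case: (_ \in studs_of_lect _ _ _) => //; case: (_ < _)%N => // nc.
  by case: nc; split=> //; rewrite orbT.
- rewrite /=; case aMb: (val a \in M); case bMb: (val b \in M);
    try by case: (envies _ _ _ _).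
  have -> // : envies I M (stud a) (stud b).
  apply/existsP; exists (proj b); rewrite /stud /proj -surjective_pairing bMb /=.
  by apply/existsP; exists (val a).2; rewrite -surjective_pairing aMb.
(* Without envy, heights in the range from 1 to [n1] differ by less than [n1]. *)
- rewrite /=; have := hmono i i'; have := hb i; have := hb i'.
  by case: (envies _ _ _ _) => hi hi' lt_h; [have := lt_h isT|]; lia.
Qed.

Lemma stable_feasible M : stable_matching I M ->
  exists2 S : assignment I, feasible S & matching_of S = M.
Proof.
move=> sM; have [[aM fM _ _] _ nocoal] := sM.
have irr : irreflexive (envies I M).
  move=> i; apply/existsP=> -[q /andP[qM /existsP[p /andP[pM]]]].
  by rewrite (fM _ _ _ qM pM) sprefers_irr.
(* [coalition] unfolds to exactly the cycles that [acyclic_height] excludes. *)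
have [h hb hmono] := acyclic_height irr nocoal.
rewrite card_ord in hb.
exists (assignment_of M h); first exact: stable_assignment_feasible.
exact: matching_of_assignment_of.
Qed.

Lemma feasible_objective S : feasible S -> objective S = #|matching_of S|%:Z.
Proof.
move=> fS; apply: objective_card; last exact: matching_of_acceptable.
exact: encodes_matching_of (bin_x fS).
Qed.

End Instance.

Theorem theorem1 (n1 n2 n3 : nat) (I : spap n1 n2 n3) (S : assignment I)
    (feasS : feasible S) :
  stable_matching I (matching_of S) /\
  (optimal S <-> max_stable_matching I (matching_of S)).
Proof.
split; first exact: feasible_stable.
split=> [[_ optS]|[_ maxM]]; split=> //.
- exact: feasible_stable.
(* Any competing stable matching comes from some feasible [S'], to which optimality applies. *)
- move=> M' /stable_feasible[S' fS' <-].
  by rewrite -lez_nat -!feasible_objective // optS.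
- move=> S' fS'; rewrite !feasible_objective // lez_nat.
  exact/maxM/feasible_stable.
Qed.
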